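(* Let $m\geq 2$ and $n\geq 4m+2$ be integers, let $S=\{0,1,\dots,m\}$, and let $G=J_S(n,2m+1)$. Let $C$ be the set of vertices $c$ of $G$ with $c\subset\{1,\dots,2m+2\}$ (i.e. the $(2m+1)$-subsets of $\{1,\dots,2m+2\}$). Then $C$ is a (Godsil–McKay) switching set in $G$.
   Context: For integers $n\geq k\geq 2$ and $S\subseteq\{0,1,\dots,k-1\}$, $J_S(n,k)$ is the graph whose vertices are the $k$-subsets of $[n]=\{1,\dots,n\}$, two $k$-subsets $A,B$ being adjacent if $|A\cap B|\in S$. A subset $C$ of the vertex set of a graph $G$ is a (Godsil–McKay) switching set if (1) any two vertices of $C$ have the same number of neighbours in $C$, and (2) every vertex of $G$ not in $C$ is adjacent to exactly $0$, $|C|/2$ or $|C|$ vertices of $C$. *)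

(* Defs.v *)
From HB Require Import structures.
From mathcomp Require Import all_boot.

Set Implicit Arguments.
Unset Strict Implicit.
Unset Printing Implicit Defensive.

Record sgraph := SGraph {
  vertex :> finType;
  adj : rel vertex;
  adj_sym : symmetric adj;
  adj_irrefl : irreflexive adj
}.

(* The ground set [n] = {1, ..., n} is represented by 'I_n = {0, ..., n - 1},
   so that i : 'I_n stands for the element i + 1 of [n]. *)
Definition ksubset (n k : nat) : finType := {A : {set 'I_n} | #|A| == k}.

(* The set S of intersection sizes is a subset of 'I_k = {0, ..., k - 1};
   k itself is excluded, which makes the graph loopless. *)
Definition johnson_adj (n k : nat) (S : {set 'I_k}) : rel (ksubset n k) :=
  fun A B => [exists s in S, #|val A :&: val B| == s].

Lemma johnson_adj_sym (n k : nat) (S : {set 'I_k}) :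
  symmetric (@johnson_adj n k S).
Proof. by move=> A B; rewrite /johnson_adj setIC. Qed.

Lemma johnson_adj_irrefl (n k : nat) (S : {set 'I_k}) :
  irreflexive (@johnson_adj n k S).
Proof.
move=> A; apply/existsP => -[s /andP[_]].
by rewrite setIid (eqP (valP A)) gtn_eqF.
Qed.

Definition johnson_graph (n k : nat) (S : {set 'I_k}) : sgraph :=
  SGraph (@johnson_adj_sym n k S) (@johnson_adj_irrefl n k S).

Definition nb_neighbours (G : sgraph) (C : {set G}) (x : G) : nat :=
  #|[set y in C | adj x y]|.

(* "|C| / 2 neighbours" is the exact half, so it is stated without the
   truncated division. *)
Definition switching_set (G : sgraph) (C : {set G}) : Prop :=
  (forall x y : G, x \in C -> y \in C ->
     nb_neighbours C x = nb_neighbours C y) /\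
  (forall x : G, x \notin C ->
     [\/ nb_neighbours C x = 0,
         2 * nb_neighbours C x = #|C|
       | nb_neighbours C x = #|C| ]).

(* Main.v *)
(* Write X = {1, ..., 2m+2}: the vertices in C are the sets X \ {i} with i in X.
   A vertex A meets X \ {i} in |A ∩ X| - [i ∈ A] points, so with t = |A ∩ X| it is
   adjacent to all of C if t <= m, to the m+1 = |C|/2 sets X \ {i} with i in A
   if t = m+1, and to none of C if t >= m+2, which includes all A in C. *)
Require Import Defs.
From mathcomp Require Import all_boot.
From mathcomp Require Import zify.

(** The map [i |-> X :\ i] is a bijection from [X] onto its [k]-subsets. Keeping [P] arbitrary lets
    one count give both the size of [C] and the numbers of neighbours. *)
Lemma card_ksubset_setD1 (n k : nat) (X : {set 'I_n}) (P : pred {set 'I_n}) :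
  #|X| = k.+1 ->
  #|[set c : ksubset n k | (val c \subset X) && P (val c)]| =
  #|[set i in X | P (X :\ i)]|.
Proof.
move=> cardX.
rewrite -(card_imset _ (@val_inj _ _ (ksubset n k))).
rewrite -[RHS](@card_in_imset _ _ (fun i => X :\ i)); last first.
  move=> i j; rewrite !inE => /andP[iX _] /andP[jX _] eq_ij.
  (* The only point of [X] missing from [X :\ j] is [j], and [i] is missing from it. *)
  by have := setD11 i X; rewrite eq_ij !inE iX andbT => /negbFE/eqP.
congr #|pred_of_set _|; apply/setP => A; apply/imsetP/imsetP.
- case=> c; rewrite inE => /andP[cX Pc] ->.
  (* The preimage of [c] is the single point of [X] that [c] omits. *)
  have /cards1P[i Xci] : #|X :\: val c| == 1.
    by rewrite cardsDS // cardX (eqP (valP c)) subSnn.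
  have cE : val c = X :\ i by rewrite -Xci setDDr setDv set0U; apply/esym/setIidPr.
  exists i => //; rewrite inE -cE Pc andbT.
  by have := set11 i; rewrite -Xci inE => /andP[].
- case=> i; rewrite inE => /andP[iX PXi] ->.
  have cardXi : #|X :\ i| == k by have := cardsD1 i X; rewrite iX cardX => -[->].
  by exists (Sub (X :\ i) cardXi); rewrite // inE SubK subD1set.
Qed.

Lemma johnson_adj_leq (n k m : nat) (A B : ksubset n k) :
  m < k ->
  johnson_adj [set s : 'I_k | s <= m] A B = (#|val A :&: val B| <= m).
Proof.
move=> lt_mk; apply/existsP/idP => [[s] | leABm].
  by rewrite inE => /andP[le_sm /eqP->].
(* Since [m < k], the intersection size itself is an element of ['I_k] and serves as the witness. *)
by exists (Ordinal (leq_ltn_trans leABm lt_mk)); rewrite inE /= leABm eqxx.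
Qed.

Lemma card_ord_ltn (n k : nat) : k <= n -> #|[set i : 'I_n | i < k]| = k.
Proof.
move=> le_kn.
have widen_inj : injective (widen_ord le_kn) by move=> i j /(congr1 val) /= /val_inj.
rewrite -[RHS]card_ord -(card_imset _ widen_inj).
congr #|pred_of_set _|; apply/setP => i; rewrite inE; apply/idP/imsetP => [lt_ik | [j _ ->]].
  by exists (Ordinal lt_ik) => //; apply: val_inj.
exact: (ltn_ord j).
Qed.

Theorem theorem2 (m n : nat) (hm : 2 <= m) (hn : 4 * m + 2 <= n) :
  let S : {set 'I_(2 * m + 1)} := [set s : 'I_(2 * m + 1) | s <= m] in
  let G : sgraph := johnson_graph n S in
  let C : {set G} :=
    [set c : ksubset n (2 * m + 1) |
       val c \subset [set i : 'I_n | i < 2 * m + 2]] in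
  switching_set C.
Proof.
move=> S G C; pose X := [set i : 'I_n | i < 2 * m + 2].
have cardX : #|X| = (2 * m + 1).+1 by rewrite card_ord_ltn; lia.
have cardC : #|C| = (2 * m + 1).+1.
  have -> : C = [set c : ksubset n _ | (val c \subset X) && predT (val c)].
    by apply/setP => c; rewrite !inE andbT.
  rewrite (card_ksubset_setD1 _ _ _ predT cardX) -cardX.
  by congr #|pred_of_set _|; apply/setP => i; rewrite !inE andbT.
(* The subtraction never truncates: if [i] lies in both [X] and [A], then [val A :&: X] is
   nonempty. *)
have nbE (A : G) :
    nb_neighbours C A =
    #|[set i in X | #|val A :&: X| - (i \in val A) <= m]|.
  transitivity
    #|[set c : ksubset n (2 * m + 1) | (val c \subset X) && (#|val A :&: val c| <= m)]|.
    congr #|pred_of_set _|; apply/setP => c.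
    by rewrite !inE /= johnson_adj_leq //; lia.
  rewrite (card_ksubset_setD1 _ _ _ (fun B => #|val A :&: B| <= m) cardX).
  congr #|pred_of_set _|; apply/setP => i; rewrite !inE; case iX: (i < _) => //=.
  by rewrite setIDA (cardsD1 i (val A :&: X)) !inE iX andbT addKn.
have nb0 (A : G) : m.+1 < #|val A :&: X| -> nb_neighbours C A = 0.
  move=> ltAX; rewrite nbE; apply/eqP; rewrite cards_eq0; apply/eqP/setP => i.
  by rewrite !inE; move: #|_| (i \in val A) ltAX => t []; lia.
split=> [A B | A _].
  have nbC (c : G) : c \in C -> nb_neighbours C c = 0.
    rewrite inE => /setIidPl cX; apply: nb0.
    (* Here [val c :&: X] is [val c], of size [2 * m + 1], which exceeds [m.+1] because [m] is
       positive. *)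
    by rewrite cX (eqP (valP c)); lia.
  by move=> /nbC-> /nbC->.
case: (ltngtP #|val A :&: X| m.+1) => [ltAX | /nb0 -> | eqAX].
- apply: Or33; rewrite cardC -cardX nbE.
  by congr #|pred_of_set _|; apply/setP => i; rewrite !inE; move: #|_| ltAX => t; lia.
- exact: Or31.
- apply: Or32; rewrite cardC nbE eqAX.
  (* At the threshold size [m.+1], the bound holds exactly when removing [i] loses a point of
     [A]. *)
  have -> : [set i in X | m.+1 - (i \in val A) <= m] = val A :&: X.
    by apply/setP => i; rewrite !inE; case: (i \in val A); rewrite /=; lia.
  by rewrite eqAX; lia.
Qed.
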